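(* Let $G$ be a fixed edge-ordered graph with labeling $l$ whose minimal edge is $ab$. If there exist two vertices $v,w\in N_G(a)\cap N_G(b)$ such that $l(av)<l(aw)$ and $l(bv)>l(bw)$, then \[sat_m(n,G)\ \ge\ ssat_m(n,G)=\Omega(n\sqrt{\log n}).\]
   Context: An edge-ordered graph is a finite simple graph together with a linear order on its edge set given by an injective labeling $l:E\to\mathbb{N}$ (or $l:E\to\mathbb{R}$). An edge-ordered graph $H$ contains $G$ (has a copy of $G$) if $G$ is isomorphic, by an isomorphism respecting the edge-order, to a subgraph of $H$ with the induced order; otherwise $H$ is $G$-free. The minimal edge is the edge with the smallest label. $N_G(a)$ denotes the open neighborhood of $a$ in $G$. $ssat_m(n,G)$ is the minimum number of edges in an edge-ordered graph $H$ on $n$ vertices such that adding to $H$ any missing edge, inserted at the beginning of the linear order (i.e. with a label smaller than all labels of $H$), creates a new copy of $G$ (one using the added edge). $sat_m(n,G)$ is defined in the same way with the additional requirement that $H$ is $G$-free. Asymptotic notation is for $n\to\infty$ with $G$ fixed. *)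

(* Defs.v *)
From mathcomp Require Import all_boot all_order all_algebra.
From mathcomp Require Import all_classical all_reals all_analysis.
Import Order.TTheory GRing.Theory Num.Theory.
Import numFieldNormedType.Exports.

Set Implicit Arguments.
Unset Strict Implicit.
Unset Printing Implicit Defensive.

(* Only the values of [lab] on [edges] are meaningful. *)
Record eograph (T : finType) := EOGraph {
  edges : {set {set T}};
  lab : {set T} -> nat;
  edges_card2 : {in edges, forall e : {set T}, #|e| = 2};
  lab_inj : {in edges &, injective lab}
}.

Section EdgeOrderedGraphs.
Variable T : finType.
Implicit Types (G : eograph T) (e f : {set T}).

Definition neighborhood G (a : T) : {set T} :=
  [set v | [set a; v]%SET \in edges G]%SET.

Definition is_min_edge G e : Prop :=
  e \in edges G /\ {in edges G, forall f, (lab G e <= lab G f)%N}.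

(* The old labels are shifted by one, which keeps their order and frees the
   label 0 for the new edge. *)
Definition add_min_lab (l : {set T} -> nat) e : {set T} -> nat :=
  fun f => if f == e then 0%N else (l f).+1.

Lemma add_min_card2 G e (he : #|e| = 2) :
  {in (e |: edges G)%SET, forall f, #|f| = 2}.
Proof. by move=> f /setU1P[->|/edges_card2]. Qed.

Lemma add_min_lab_inj G e :
  {in (e |: edges G)%SET &, injective (add_min_lab (lab G) e)}.
Proof.
move=> f g; rewrite !in_setU1 /add_min_lab.
case: eqP => [->|_] /=; case: eqP => [->|_] //= fG gG [].
exact: lab_inj fG gG.
Qed.

Definition add_min G e (he : #|e| = 2) : eograph T :=
  EOGraph (add_min_card2 (G := G) he) (@add_min_lab_inj G e).

End EdgeOrderedGraphs.

(* [phi] is an order-respecting isomorphism from [G] onto the subgraph of [H]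
   with vertex set [phi @: V] and edge set [copy_edges G phi]. *)
Definition is_copy (V W : finType) (G : eograph V) (H : eograph W)
    (phi : V -> W) : Prop :=
  [/\ injective phi,
      {in edges G, forall e : {set V}, (phi @: e)%SET \in edges H} &
      {in edges G &, forall e f : {set V},
        (lab H (phi @: e)%SET < lab H (phi @: f)%SET)%N
          = (lab G e < lab G f)%N}].

Definition copy_edges (V W : finType) (G : eograph V) (phi : V -> W) :
    {set {set W}} :=
  [set (phi @: e)%SET | e : {set V} in edges G]%SET.

Definition eofree (V W : finType) (G : eograph V) (H : eograph W) : Prop :=
  ~ exists phi : V -> W, is_copy G H phi.

Definition semisaturated_min (V W : finType) (G : eograph V) (H : eograph W) :
    Prop :=
  forall (e : {set W}) (he : #|e| = 2), e \notin edges H ->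
  exists phi : V -> W, is_copy G (add_min H he) phi /\ e \in copy_edges G phi.

Definition saturated_min (V W : finType) (G : eograph V) (H : eograph W) :
    Prop :=
  eofree G H /\ semisaturated_min G H.

(* The default value 0 is only used if [P] is empty. *)
Definition min_nat (P : set nat) : nat :=
  xget 0%N (fun m : nat => P m /\ forall k : nat, P k -> (m <= k)%N).

(* The complete graph on 'I_n is always semisaturated, so the minimum exists. *)
Definition ssat_m (V : finType) (n : nat) (G : eograph V) : nat :=
  min_nat (fun m : nat => exists H : eograph 'I_n,
    semisaturated_min G H /\ #|edges H| = m).

(* If [G] has an edge, greedily adding smallest edges to the edgeless graph
   while it stays [G]-free ends in a saturated graph, so the minimum exists. *)
Definition sat_m (V : finType) (n : nat) (G : eograph V) : nat :=
  min_nat (fun m : nat => exists H : eograph 'I_n,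
    saturated_min G H /\ #|edges H| = m).

(* Main.v *)
(* The minimal edge of a copy of [G] created by a new minimal edge [xy] is [xy]
   itself, so non-adjacent vertices [x], [y] of a semisaturated graph have two
   common neighbors that are ordered differently by the edges at [x] and by the
   edges at [y].  Pick a set [S] of ordered pairs of vertices at random, and say
   that [S] agrees with [x] if it induces on the neighborhood of [x] the order
   given by the edges at [x]; for a vertex of degree at most [D] this has
   probability at least [2 ^ - D ^ 2].  The vertices that agree with a given [S]
   are pairwise adjacent, so at most [D + 1] of them have degree at most [D].
   Hence at most [(D + 1) 2 ^ (D ^ 2)] vertices have degree at most [D], which is
   less than half of them for some [D] of order [sqrt (ln n)]. *)
Require Import Defs.
From mathcomp Require Import all_boot all_order all_algebra.
From mathcomp Require Import all_classical all_reals all_analysis.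
From mathcomp Require Import zify.
Import Order.TTheory GRing.Theory Num.Theory.
Import numFieldNormedType.Exports.
Set Implicit Arguments.
Unset Strict Implicit.
Unset Printing Implicit Defensive.
Local Open Scope classical_set_scope.
Local Open Scope ring_scope.

(** * Minima of sets of natural numbers *)

Lemma min_natP (P : set nat) : (exists m, P m) -> P (min_nat P).
Proof.
move=> [m Pm].
have exP : exists m, `[<P m>] by exists m; apply/asboolP.
rewrite /min_nat; case: xgetP => [k _ []//|noP].
case: (ex_minnP exP) => k /asboolP Pk kmin.
by case: (noP k); split=> // j Pj; apply/kmin/asboolP.
Qed.

Lemma min_nat_le (P : set nat) k : P k -> (min_nat P <= k)%N.
Proof.
move=> Pk; rewrite /min_nat.
by case: xgetP => [m _ [_ ->]|].
Qed.

(** * Degrees and the number of edges *)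

Section Neighborhoods.
Variables (W : finType) (H : eograph W).
Implicit Types (x y : W).

Lemma mem_neighborhood x y :
  (y \in neighborhood H x) = ([set x; y]%SET \in edges H).
Proof. by rewrite inE. Qed.

Lemma neighborhood_neq {x y} : y \in neighborhood H x -> x != y.
Proof.
rewrite mem_neighborhood => /edges_card2; rewrite cards2.
by case: eqP.
Qed.

(** Since [y] is recovered from [x] and [[set x; y]], each degree is at most the number of edges at
    [x]; exchanging the sums counts every edge twice. *)
Lemma sum_card_neighborhood :
  (\sum_x #|neighborhood H x| <= 2 * #|edges H|)%N.
Proof.
have deg x : (#|neighborhood H x| <= \sum_(e in edges H) (x \in e))%N.
  rewrite -big_mkcondr /= sum1_card.
  have inj : {in neighborhood H x &, injective (fun y => [set x; y]%SET)}.
    move=> y z yx _ /setP/(_ y).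
    by rewrite !inE eqxx orbT eq_sym (negPf (neighborhood_neq yx)) => /esym/eqP.
  rewrite -(card_in_imset inj); apply/subset_leq_card/fintype.subsetP => e.
  case/imsetP=> y; rewrite mem_neighborhood => ye ->.
  by rewrite unfold_in /= ye !inE eqxx.
apply: (@leq_trans (\sum_x \sum_(e in edges H) (x \in e))).
  exact: leq_sum.
rewrite exchange_big /= mulnC -sum_nat_const leq_sum // => e eH.
by rewrite -big_mkcond sum1_card (edges_card2 eH).
Qed.

End Neighborhoods.

(** * Counting vertices of small degree *)

Section DisagreeingNeighbors.
Variables (W : finType) (H : eograph W).
Implicit Types (x y p q : W) (S : {set W * W}) (D : nat).

Definition precedes x p q : bool :=
  (lab H [set x; p]%SET < lab H [set x; q]%SET)%N.

(** The one consequence of semisaturation on which the edge count rests. *)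
Definition nonadjacent_disagree : Prop :=
  forall x y, x != y -> y \notin neighborhood H x ->
  exists p q, [/\ p \in (neighborhood H x :&: neighborhood H y)%SET,
    q \in (neighborhood H x :&: neighborhood H y)%SET &
    precedes x p q != precedes y p q].

(** Probabilities become counts among all [2 ^ (#|W| ^ 2)] sets of pairs. Arbitrary relations,
    rather than linear orders, keep these counts powers of two. *)
Definition agreeing x : {set {set W * W}} :=
  [set S : {set W * W} | [forall p in neighborhood H x,
    forall q in neighborhood H x, ((p, q) \in S) == precedes x p q]]%SET.

Lemma agreeingP x S :
  reflect {in neighborhood H x &, forall p q, ((p, q) \in S) = precedes x p q}
    (S \in agreeing x).
Proof.
rewrite inE; apply: (iffP forall_inP) => [h p q pN qN|h p pN].
  by apply/eqP; move: (h p pN) => /forall_inP/(_ q qN).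
by apply/forall_inP=> q qN; rewrite h.
Qed.

(** Agreement prescribes [S] only inside [N * N], as the set [R] below; adding to [R] any set [U] of
    pairs outside [N * N] gives an agreeing set, and distinct [U] give distinct sets. *)
Lemma card_agreeing x D : (#|neighborhood H x| <= D)%N ->
  (2 ^ (#|W| ^ 2) <= 2 ^ (D ^ 2) * #|agreeing x|)%N.
Proof.
move=> degx; set N := neighborhood H x in degx *.
pose R := [set u in finset.setX N N | precedes x u.1 u.2]%SET.
have inj : {in powerset (~: finset.setX N N)%SET &,
    injective (fun U => (U :|: R)%SET)}.
  move=> U U'; rewrite !powersetE => /fintype.subsetP sU.
  move=> /fintype.subsetP sU' /setP eqUR.
  apply/setP => u; move: (eqUR u) (sU u) (sU' u).
  rewrite !finset.in_setU [u \in R]finset.in_set !finset.in_setC.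
  case: (u \in finset.setX N N) => /=; last by rewrite !orbF.
  move=> _; case: (u \in U) => [/(_ isT)//|_];
    by case: (u \in U') => // /(_ isT).
have sub : ((fun U => (U :|: R)%SET) @: powerset (~: finset.setX N N)%SET
    \subset agreeing x)%SET.
  apply/fintype.subsetP => _ /imsetP[U + ->].
  rewrite inE => /fintype.subsetP sU.
  apply/agreeingP => p q pN qN.
  rewrite finset.in_setU finset.in_set finset.in_setX pN qN /=.
  case: (boolP (_ \in U)) => // /sU.
  by rewrite finset.in_setC finset.in_setX pN qN.
have := subset_leq_card sub; rewrite (card_in_imset inj) card_powerset.
move=> /(leq_mul (leqnn (2 ^ (D ^ 2)))); apply: leq_trans.
rewrite -expnD leq_exp2l //.
have := cardsC (finset.setX N N); rewrite cardsX card_prod -!mulnn => <-.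
by rewrite leq_add2r leq_mul.
Qed.

Hypothesis disagree : nonadjacent_disagree.

Lemma agreeing_adjacent x y S : x != y ->
  S \in agreeing x -> S \in agreeing y -> y \in neighborhood H x.
Proof.
move=> xy /agreeingP Sx /agreeingP Sy; apply/negPn/negP => yNx.
have [p [q [/finset.setIP[px py] /finset.setIP[qx qy] /eqP[]]]] :=
  disagree xy yNx.
by rewrite -Sx // Sy.
Qed.

(** Double counting of the pairs [(x, S)] with [x] in [L] and [S] agreeing with [x]: [le1] counts by
    vertices, [le2] by sets. *)
Lemma card_small_degree D :
  (#|[set x | #|neighborhood H x| <= D]%N%SET| <= D.+1 * 2 ^ (D ^ 2))%N.
Proof.
set L := [set _ | _]%SET.
have cliqueS S : (\sum_(x in L) (S \in agreeing x) <= D.+1)%N.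
  rewrite -big_mkcondr /= sum1_card.
  have [x /andP[xL Sx]|none] := pickP [pred x in L | S \in agreeing x];
    last by rewrite eq_card0.
  (* All vertices that agree with [S] lie in the closed neighborhood of any one of them. *)
  apply: (@leq_trans #|x |: neighborhood H x|%SET).
    apply/subset_leq_card/fintype.subsetP => y.
    rewrite unfold_in => /andP[_ Sy].
    rewrite finset.in_setU1; case: eqVneq => //= yx.
    by rewrite (agreeing_adjacent _ Sx Sy) // eq_sym.
  move: xL; rewrite cardsU1 inE => degx.
  by case: (x \notin _); rewrite ?add1n ?ltnS // add0n leqW.
have le1 : (#|L| * 2 ^ (#|W| ^ 2)
    <= 2 ^ (D ^ 2) * \sum_(x in L) #|agreeing x|)%N.
  rewrite -sum_nat_const big_distrr leq_sum //= => x.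
  by rewrite inE; apply: card_agreeing.
have le2 : (\sum_(x in L) #|agreeing x| <= 2 ^ (#|W| ^ 2) * D.+1)%N.
  rewrite (eq_bigr (fun x => \sum_S (S \in agreeing x))%N); last first.
    by move=> x _; rewrite -big_mkcond sum1_card.
  rewrite exchange_big /=; apply: (@leq_trans (\sum_(S : {set W * W}) D.+1)).
    exact: leq_sum.
  rewrite sum_nat_const (_ : #|_| = 2 ^ (#|W| ^ 2))%N //.
  have := card_powerset [set: W * W]%SET.
  by rewrite finset.powersetT !cardsT card_prod mulnn.
have := leq_trans le1 (leq_mul (leqnn _) le2).
by rewrite mulnCA [X in (_ <= X)%N]mulnC leq_pmul2r ?expn_gt0 // mulnC.
Qed.

(** At least half of the vertices have degree at least [k], so the degree sum is at least
    [#|W| * k / 2]; it is at most twice the number of edges. *)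
Lemma card_edges_disagree k : (2 ^ (k ^ 2) <= #|W|)%N ->
  (#|W| * k <= 4 * #|edges H|)%N.
Proof.
case: k => [|D] leW; first by rewrite muln0.
set L := [set x | #|neighborhood H x| <= D]%N%SET.
have leL : (2 * #|L| <= #|W|)%N.
  apply: leq_trans leW; have := card_small_degree D; rewrite -/L => leL.
  apply: leq_trans (leq_mul (leqnn 2) leL) _.
  (* The summand 1 pays for the factor 2, the first [D] for [D.+1 <= 2 ^ D]; the last [D] is
     slack. *)
  have -> : (D.+1 ^ 2 = 1 + (D + D ^ 2) + D)%N by rewrite -!mulnn; lia.
  rewrite expnD (leq_trans _ (leq_pmulr _ _)) ?expn_gt0 //.
  rewrite !expnD expn1 leq_pmul2l // leq_pmul2r ?expn_gt0 //.
  exact: ltn_expl.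
have leC : (#|~: L|%SET * D.+1 <= 2 * #|edges H|)%N.
  apply: leq_trans (sum_card_neighborhood H).
  rewrite -sum_nat_const [X in (_ <= X)%N](bigID (fun x => x \in ~: L)%SET) /=.
  apply: leq_trans (leq_addr _ _); apply: leq_sum => x.
  by rewrite !inE -ltnNge.
by have := cardsC L; nia.
Qed.

End DisagreeingNeighbors.

(** * Saturated graphs and their disagreeing common neighbors *)

Section Saturation.
Variables (V : finType) (G : eograph V).

(** Away from the new edge all labels are shifted by one, so their comparisons are unchanged. *)
Lemma add_min_copy (W : finType) (H : eograph W) (e : {set W}) (he : #|e| = 2)
    (phi : V -> W) :
  is_copy G (add_min H he) phi -> e \notin copy_edges G phi -> is_copy G H phi.
Proof.
move=> [inj sub ord] eG.
have ne f : f \in edges G -> (phi @: f)%SET != e.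
  by move=> fG; apply: contraNneq eG => <-; apply/imsetP; exists f.
split=> // [f fG|f g fG gG].
  by have := sub f fG; rewrite finset.in_setU1 (negPf (ne f fG)).
by rewrite -ord //= /add_min_lab !(negPf (ne _ _)).
Qed.

(** A [G]-free graph with the most edges is saturated: a new minimal edge must create a copy, which
    uses that edge by [add_min_copy]. The edge [e0] makes the edgeless graph [G]-free. *)
Lemma saturated_min_exists (W : finType) (e0 : {set V}) : e0 \in edges G ->
  exists H : eograph W, saturated_min G H.
Proof.
move=> e0G.
pose P m := `[<exists2 H : eograph W, eofree G H & #|edges H| = m>].
have card2_0 : {in @finset.set0 {set W}, forall e : {set W}, #|e| = 2}.
  by move=> e; rewrite inE.
have inj0 : {in @finset.set0 {set W} &, injective (fun=> 0%N)}.
  by move=> e f; rewrite inE.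
have exP : exists m, P m.
  exists 0%N; apply/asboolP; exists (EOGraph card2_0 inj0); last exact: cards0.
  by move=> [phi [_ /(_ _ e0G)]]; rewrite inE.
have ubP m : P m -> (m <= #|{set W}|)%N.
  by move=> /asboolP[H _ <-]; exact: max_card.
case: (ex_maxnP exP ubP) => m /asboolP[H freeH cardH] maxm.
exists H; split=> // e he eH; apply: contrapT => noe.
suff /maxm : P m.+1 by rewrite ltnn.
apply/asboolP; exists (add_min H he); last by rewrite /= cardsU1 eH cardH.
move=> [phi copy]; have [eG|eG] := boolP (e \in copy_edges G phi).
  by apply: noe; exists phi.
by apply: freeH; exists phi; apply: add_min_copy copy eG.
Qed.

(** Excludes the default value of [min_nat]. *)
Lemma ssat_m_attained n (e0 : {set V}) : e0 \in edges G ->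
  exists H : eograph 'I_n, semisaturated_min G H /\ #|edges H| = ssat_m n G.
Proof.
move=> /(@saturated_min_exists 'I_n)[H [_ semiH]].
pattern (ssat_m n G); apply: min_natP.
by exists #|edges H|, H.
Qed.

Lemma sat_m_attained n (e0 : {set V}) : e0 \in edges G ->
  exists H : eograph 'I_n, saturated_min G H /\ #|edges H| = sat_m n G.
Proof.
move=> /(@saturated_min_exists 'I_n)[H satH].
pattern (sat_m n G); apply: min_natP.
by exists #|edges H|, H.
Qed.

Lemma ssat_m_le_sat_m n (e0 : {set V}) : e0 \in edges G ->
  (ssat_m n G <= sat_m n G)%N.
Proof.
move=> /(sat_m_attained n)[H [[_ semiH] cardH]].
by apply: min_nat_le; exists H.
Qed.

Lemma semisaturated_min_disagree (W : finType) (H : eograph W) (a b v w : V) :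
  is_min_edge G [set a; b]%SET ->
  v \in (neighborhood G a :&: neighborhood G b)%SET ->
  w \in (neighborhood G a :&: neighborhood G b)%SET ->
  (lab G [set a; v]%SET < lab G [set a; w]%SET)%N ->
  (lab G [set b; v]%SET > lab G [set b; w]%SET)%N ->
  semisaturated_min G H -> nonadjacent_disagree H.
Proof.
move=> [abG minab] /finset.setIP[va vb] /finset.setIP[wa wb] ha hb semiH.
move=> x y xy xyH.
have he : #|[set x; y]%SET| = 2 by rewrite cards2 xy.
rewrite mem_neighborhood in xyH.
have [phi [[inj sub ord] /imsetP[f fG ef]]] := semiH _ he xyH.
(* The image of [f] has the new label 0, so [ab] cannot have a smaller label than [f]. *)
have fab : f = [set a; b]%SET.
  apply: (lab_inj fG abG); apply/eqP; rewrite eqn_leq minab // andbT leqNgt.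
  by rewrite -ord //= -ef /add_min_lab eqxx.
rewrite {}fab imsetU1 imset_set1 in ef.
(* A common neighbor [d] of [a] and [b] differs from both, so [phi d] is not on the new edge and the
   image of [cd] is an old edge. *)
have inH c d : d \in neighborhood G c ->
    d \in neighborhood G a -> d \in neighborhood G b ->
    [set phi c; phi d]%SET \in edges H /\
    lab (add_min H he) (phi @: [set c; d])%SET
      = (lab H [set phi c; phi d]%SET).+1.
  move=> dc da db.
  rewrite mem_neighborhood in dc; have := sub _ dc.
  rewrite imsetU1 imset_set1 /= /add_min_lab finset.in_setU1.
  suff /negPf-> : [set phi c; phi d]%SET != [set x; y]%SET by [].
  apply/eqP; rewrite ef => /setP/(_ (phi d)).
  rewrite !inE eqxx orbT !(inj_eq inj) ![d == _]eq_sym.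
  by rewrite (negPf (neighborhood_neq da)) (negPf (neighborhood_neq db)).
have [avH lav] := inH a v va va vb; have [awH law] := inH a w wa wa wb.
have [bvH lbv] := inH b v vb va vb; have [bwH lbw] := inH b w wb wa wb.
have [avG awG] : [set a; v]%SET \in edges G /\ [set a; w]%SET \in edges G.
  by rewrite -!mem_neighborhood.
have [bvG bwG] : [set b; v]%SET \in edges G /\ [set b; w]%SET \in edges G.
  by rewrite -!mem_neighborhood.
have precv : precedes H (phi a) (phi v) (phi w).
  by have := ord _ _ avG awG; rewrite lav law ltnS /precedes => ->.
have precw : precedes H (phi b) (phi w) (phi v).
  by have := ord _ _ bwG bvG; rewrite lbv lbw ltnS /precedes => ->.
have nprec : ~~ precedes H (phi b) (phi v) (phi w).
  by rewrite -leqNgt ltnW.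
exists (phi v), (phi w).
(* The new edge is unordered, so [phi] may send [a] to either end; disagreement is symmetric in the
   two ends. *)
have [] : (x = phi a /\ y = phi b) \/ (x = phi b /\ y = phi a).
  have := finset.set21 x y; rewrite ef => /set2P[] xE;
    have := finset.set22 x y; rewrite ef => /set2P[] yE; try by [left|right];
    by move: xy; rewrite xE yE eqxx.
all: by move=> [-> ->]; split;
  rewrite ?inE ?mem_neighborhood ?avH ?awH ?bvH ?bwH //
    precv (negPf nprec).
Qed.

End Saturation.

(** * The asymptotic bound *)

Lemma sqrt_ln_le (R : realType) (n k : nat) : (n < 2 ^ (k ^ 2))%N ->
  Num.sqrt (ln n%:R) <= k%:R :> R.
Proof.
case: n => [|n] ltn; first by rewrite ln0 // sqrtr0.
rewrite -[k%:R]ger0_norm // -sqrtr_sqr ler_sqrt ?sqr_ge0 //.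
have : ln n.+1%:R <= ln (2 ^+ (k ^ 2)) :> R.
  by rewrite ler_ln ?posrE ?exprn_gt0 // -natrX ler_nat ltnW.
(* It remains to use [ln 2 <= 1], an instance of [ln (1 + x) <= x]. *)
move=> /le_trans; apply; rewrite lnXn // -natrX -[leLHS]mulr_natl ler_piMr //.
by apply: (@le_ln1Dx R 1).
Qed.

Theorem theorem18 (R : realType) (V : finType) (G : eograph V) (a b : V)
    (hab : is_min_edge G [set a; b]%SET) (v w : V)
    (hv : v \in (neighborhood G a :&: neighborhood G b)%SET)
    (hw : w \in (neighborhood G a :&: neighborhood G b)%SET)
    (ha : (lab G [set a; v]%SET < lab G [set a; w]%SET)%N)
    (hb : (lab G [set b; v]%SET > lab G [set b; w]%SET)%N) :
  (forall n : nat, (ssat_m n G <= sat_m n G)%N) /\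
  ((fun n : nat => (ssat_m n G)%:R : R^o) \is
    'Omega_\oo (fun n : nat => n%:R * Num.sqrt (ln n%:R) : R^o)).
Proof.
have [abG _] := hab.
split=> [n|]; first exact: ssat_m_le_sat_m abG.
(* The constant comes from [n * sqrt (ln n) <= n * (k + 1) <= 2 * n * k <= 8 * #|edges H|], with [k]
   the largest number such that [2 ^ (k ^ 2) <= n]. *)
rewrite qualifE; apply/asboolP; exists 8^-1; first by rewrite invr_gt0.
near=> n.
(* This makes [k = 1] admissible, so the maximal [k] is positive and [k + 1 <= 2 * k]. *)
have n_ge2 : (2 <= n)%N by near: n; exact: nbhs_infty_ge.
have [H [semiH <-]] := ssat_m_attained n abG.
have disH := semisaturated_min_disagree hab hv hw ha hb semiH.
have ex1 : exists k, (2 ^ (k ^ 2) <= n)%N by exists 1%N.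
have ubk k : (2 ^ (k ^ 2) <= n)%N -> (k <= n)%N.
  move=> le_n; apply: leq_trans le_n.
  apply: leq_trans (ltnW (ltn_expl _ _)) => //.
  by rewrite -mulnn; nia.
case: (ex_maxnP ex1 ubk) => k le_n maxk.
have k_gt0 : (0 < k)%N by exact: maxk.
have lt_n : (n < 2 ^ (k.+1 ^ 2))%N.
  by rewrite ltnNge; apply/negP => /maxk; rewrite ltnn.
have := @card_edges_disagree _ H disH k; rewrite card_ord => /(_ le_n) leE.
rewrite !ger0_norm ?mulr_ge0 ?sqrtr_ge0 ?ler0n // mulrC ler_pdivrMr //.
apply: le_trans (ler_wpM2l (ler0n _ _) (sqrt_ln_le R lt_n)) _.
by rewrite -!natrM ler_nat; nia.
Unshelve. all: by end_near.
Qed.
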